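(* Let $\rho_{AB}$ be a bipartite quantum state, and let $\mathbf{E}=\{E^j\}_{j\in\mathcal J}$ be a non-empty finite family of binary-outcome POVMs $E^j=\{E^j_0,E^j_1\}$ acting on $B$. Let $$P^{\mathrm A}_{\mathrm{succ}}:=\max_{\{F_j\}_{j\in\mathcal J}}\sum_{j\in\mathcal J}\mathrm{tr}\bigl((F_j\otimes E_1^j)\rho_{AB}\bigr),\qquad P^{\mathrm{NA}}_{\mathrm{succ}}:=\max_{j\in\mathcal J}\mathrm{tr}(E_1^j\rho_B),$$ where the first maximum is over all POVMs $\{F_j\}_{j\in\mathcal J}$ acting on $A$. Then $$P^{\mathrm A}_{\mathrm{succ}}\le 2^{I_{\max}^{\mathrm{acc}}(B;A)_\rho}\,P^{\mathrm{NA}}_{\mathrm{succ}}.$$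
   Context: All registers are finite-dimensional quantum systems; $\rho_B=\mathrm{tr}_A(\rho_{AB})$. $X\le Y$ means that $Y-X$ is positive semidefinite. A measurement on $A$ with outcome register $X$ is a CPTP map $\mathcal M_{A\to X}$ of the form $\mathcal M(\rho_A)=\sum_{x}\mathrm{tr}(M_x\rho_A)\,|x\rangle\langle x|_X$, where $\{M_x\}_x$ is a POVM on $A$ (finite outcome set) and $\{|x\rangle\}$ is a fixed orthonormal basis of $\mathcal H_X$; applied to $\rho_{AB}$ it acts as the identity on $B$. $I_{\max}^{\mathrm{acc}}(B;A)_\rho$ is the smallest real number such that for every measurement $\mathcal M_{A\to X}$ there exists a density operator $\sigma_X$, of the form $\sigma_X=\sum_x\lambda_x|x\rangle\langle x|$ with $\{\lambda_x\}$ a probability distribution, with $\mathcal M(\rho_{AB})\le 2^{I_{\max}^{\mathrm{acc}}(B;A)_\rho}\,\sigma_X\otimes\rho_B$. *)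

(* Defs.v *)
(* An operator on C^n is a matrix 'M[R[i]]_n; the register AB is C^nA (x) C^nB,
   whose basis vector |i>|j> has index mxtens_index (i, j), so that *t is the
   tensor product of operators. *)
From HB Require Import structures.
From mathcomp Require Import all_boot all_order all_algebra.
From mathcomp Require Import spectral complex mxtens.
From mathcomp Require Import boolp classical_sets reals exp.

Set Implicit Arguments.
Unset Strict Implicit.
Unset Printing Implicit Defensive.

Import Order.TTheory GRing.Theory Num.Theory.

Local Open Scope classical_set_scope.
Local Open Scope ring_scope.
Local Open Scope complex_scope.
Local Open Scope sesquilinear_scope.

Section Defs.
Variable R : realType.
Local Notation C := R[i].

(* On R[i], 0 <= z says that z is real and nonnegative; hence psd matrices are
   hermitian. *)
Definition psd n (X : 'M[C]_n) : Prop :=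
  forall v : 'cV[C]_n, 0 <= (v^t* *m X *m v) 0 0.

Definition loewner_le n (X Y : 'M[C]_n) : Prop := psd (Y - X).

Definition density n (rho : 'M[C]_n) : Prop := psd rho /\ \tr rho = 1.

Definition povm (J : finType) n (F : J -> 'M[C]_n) : Prop :=
  (forall j, psd (F j)) /\ \sum_j F j = 1%:M.

Definition prob_distr (J : finType) (lambda : J -> R) : Prop :=
  (forall x, 0 <= lambda x) /\ \sum_x lambda x = 1.

(* The operator <i|_A rho_AB |i'>_A on B. *)
Definition blockB nA nB (rho : 'M[C]_(nA * nB)) (i i' : 'I_nA) : 'M[C]_nB :=
  \matrix_(j, j') rho (mxtens_index (i, j)) (mxtens_index (i', j')).

Definition ptraceA nA nB (rho : 'M[C]_(nA * nB)) : 'M[C]_nB :=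
  \sum_i blockB rho i i.

(* Phi (x) id_B, for a linear map Phi from operators on A to operators on X. *)
Definition tens_id nA nX nB (Phi : 'M[C]_nA -> 'M[C]_nX)
    (rho : 'M[C]_(nA * nB)) : 'M[C]_(nX * nB) :=
  \sum_i \sum_i' Phi (delta_mx i i') *t blockB rho i i'.

Definition measurement k nA (M : 'I_k -> 'M[C]_nA) (rho : 'M[C]_nA)
    : 'M[C]_k :=
  \sum_x \tr (M x *m rho) *: delta_mx x x.

Definition acc_bound nA nB (rho : 'M[C]_(nA * nB)) (l : R) : Prop :=
  forall (k : nat) (M : 'I_k -> 'M[C]_nA), povm M ->
  exists2 lambda : 'I_k -> R, prob_distr lambda &
    let sigma := \sum_x (lambda x)%:C *: delta_mx x x in
    loewner_le (tens_id (measurement M) rho)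
               ((2 `^ l)%:C *: (sigma *t ptraceA rho)).

(* For a density operator this set is nonempty, bounded below by 0 (take
   traces) and closed, so that its infimum is its smallest element. *)
Definition Imax_acc nA nB (rho : 'M[C]_(nA * nB)) : R :=
  inf [set l | acc_bound rho l].

(* E j true is E^j_1, and E j false is E^j_0.  The traces below are real when
   rho is a density operator.  The suprema are maxima, by compactness of the
   set of POVMs and by finiteness of J respectively. *)
Definition Psucc_A (J : finType) nA nB (rho : 'M[C]_(nA * nB))
    (E : J -> bool -> 'M[C]_nB) : R :=
  sup [set \sum_j complex.Re (\tr ((F j *t E j true) *m rho))
      | F in [set F : J -> 'M[C]_nA | povm F]].

Definition Psucc_NA (J : finType) nA nB (rho : 'M[C]_(nA * nB))
    (E : J -> bool -> 'M[C]_nB) : R :=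
  sup [set complex.Re (\tr (E j true *m ptraceA rho)) | j in [set: J]].

End Defs.

(* Main.v *)
(* Let rho_B^M = tr_A ((M (x) 1) rho).  The measured state is block diagonal
   with blocks rho_B^(M_x), so a bound l on it means rho_B^(M_x) <= 2^l lambda_x
   rho_B for every x.  Measuring A with {F_j}, pairing the j-th inequality with
   E^j_1 and summing over j bounds the adaptive success probability by 2^l times
   the nonadaptive one.  The infimum over l may be taken because some l is
   feasible: M_x <= tr(M_x) 1 gives rho_B^(M_x) <= nA lambda_x rho_B for
   lambda_x = tr(M_x) / nA. *)
Require Import Defs.
From HB Require Import structures.
From mathcomp Require Import all_boot all_order all_algebra.
From mathcomp Require Import spectral mxtens classical_sets.
From mathcomp Require Import complex reals exp.
Local Open Scope ring_scope.
Local Open Scope complex_scope.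

Set Implicit Arguments.
Unset Strict Implicit.
Unset Printing Implicit Defensive.

Import Order.TTheory GRing.Theory Num.Theory.

Local Open Scope classical_set_scope.
Local Open Scope sesquilinear_scope.

(** * Sums and traces over a product basis *)

Lemma big_mxtens_index (V : nmodType) m n (F : 'I_(m * n) -> V) :
  \sum_k F k = \sum_i \sum_j F (mxtens_index (i, j)).
Proof.
rewrite pair_big (reindex (@mxtens_index m n))/=.
  by apply: eq_bigr => -[i j].
by exists (@mxtens_unindex m n) => k _; rewrite (mxtens_indexK, mxtens_unindexK).
Qed.

Lemma mxtrace_tens (K : comPzRingType) m n (A : 'M[K]_m) (B : 'M[K]_n) :
  \tr (A *t B) = \tr A * \tr B.
Proof.
rewrite /mxtrace big_mxtens_index mulr_suml; apply: eq_bigr => i _.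
by rewrite mulr_sumr; apply: eq_bigr => j _; rewrite tensmxE.
Qed.

(** * Positive semidefinite complex matrices *)

Section PositiveMatrices.
Variable R : realType.
Local Notation C := R[i].

Lemma adjmxM m n p (A : 'M[C]_(m, n)) (B : 'M[C]_(n, p)) :
  (A *m B)^t* = B^t* *m A^t*.
Proof. by rewrite trmx_mul map_mxM. Qed.

Lemma psd_gram m n (S : 'M[C]_(m, n)) : psd (S^t* *m S).
Proof.
move=> v; rewrite mulmxA -adjmxM -mulmxA mxE sumr_ge0// => i _.
by rewrite !mxE mulrC mul_conjC_ge0.
Qed.

Lemma psd_outer n (v : 'cV[C]_n) : psd (v *m v^t*).
Proof. by rewrite -{1}[v]trmxCK; exact: psd_gram. Qed.

Lemma psd_congr m n (S : 'M[C]_(m, n)) X : psd X -> psd (S^t* *m X *m S).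
Proof. by move=> Xp v; rewrite !mulmxA -adjmxM -mulmxA; exact: Xp. Qed.

Lemma psd0 n : psd (0 : 'M[C]_n).
Proof. by move=> v; rewrite mulmx0 mul0mx mxE. Qed.

Lemma psdD n (X Y : 'M[C]_n) : psd X -> psd Y -> psd (X + Y).
Proof. by move=> Xp Yp v; rewrite mulmxDr mulmxDl mxE addr_ge0. Qed.

Lemma psd_sum (I : finType) n (X : I -> 'M[C]_n) :
  (forall i, psd (X i)) -> psd (\sum_i X i).
Proof.
move=> Xp; apply: (big_ind (@psd R n)); [exact: psd0 | exact: psdD |].
by move=> i _; exact: Xp.
Qed.

Lemma psd_delta n (i : 'I_n) : psd (delta_mx i i : 'M[C]_n).
Proof.
suff -> : delta_mx i i = (delta_mx i i)^t* *m delta_mx i i :> 'M[C]_n.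
  exact: psd_gram.
by rewrite trmx_delta map_delta_mx mul_delta_mx.
Qed.

Lemma psd_diag n (d : 'rV[C]_n) : (forall i, 0 <= d 0 i) -> psd (diag_mx d).
Proof.
move=> d0 v; rewrite mxE sumr_ge0// => i _.
by rewrite mul_mx_diag !mxE mulrAC mulr_ge0// mulrC mul_conjC_ge0.
Qed.

(** The last clause lets facts about the quadratic form pass to the eigenvalues. Normality is the
    right generality: it serves the antihermitian part of a matrix as well as the positive matrix
    itself. *)
Lemma normal_spectral n (N : 'M[C]_n) : N \is normalmx ->
  exists (P : 'M[C]_n) (d : 'rV[C]_n),
    [/\ P^t* *m P = 1%:M, N = P^t* *m diag_mx d *m P &
      forall i, exists v : 'cV[C]_n, d 0 i = (v^t* *m N *m v) 0 0].
Proof.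
move=> /orthomx_spectralP NE.
set P := spectralmx N in NE; set d := spectral_diag N in NE.
have Pu : P \is unitarymx := spectral_unitarymx N.
rewrite invmx_unitary// in NE.
exists P, d; split=> [|//|i].
  by rewrite -invmx_unitary// mulVmx// unitarymx_unit.
(* The witness is the [i]-th eigenvector, that is, the adjoint of row [i] of [P]. *)
exists (P^t* *m delta_mx i 0).
rewrite adjmxM trmxCK NE.
have /unitarymxP PP := Pu.
rewrite !mulmxA -(mulmxA _ P) PP mulmx1 -(mulmxA _ P) PP mulmx1.
by rewrite trmx_delta map_delta_mx -rowE -colE !mxE eqxx mulr1n.
Qed.

(* The antihermitian part of X is normal and its quadratic form vanishes, so
   its eigenvalues vanish. *)
Lemma psd_hermitian n (X : 'M[C]_n) : psd X -> X^t* = X.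
Proof.
move=> Xp; pose N := X - X^t*.
have Nadj : N^t* = - N.
  by rewrite /N linearB/= raddfB/= trmxCK opprB.
have /normal_spectral[P [d [_ NE dE]]] : N \is normalmx.
  by apply/normalmxP; rewrite Nadj mulmxN mulNmx.
have d0 : d = 0.
  apply/rowP => i; rewrite mxE; have [v ->] := dE i.
  have -> : v^t* *m N *m v = v^t* *m X *m v - (v^t* *m X *m v)^t*.
    by rewrite !adjmxM trmxCK /N mulmxBr mulmxBl !mulmxA.
  have /CrealP := ger0_real (Xp v).
  set Q := v^t* *m X *m v => QE; rewrite [LHS]mxE [X in _ + X]mxE.
  by rewrite [X in _ - X]mxE [X in _ - _ X]mxE QE subrr.
apply/esym/eqP; rewrite -subr_eq0 -/N NE d0.
by rewrite linear0 mulmx0 mul0mx.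
Qed.

Lemma psd_spectral n (X : 'M[C]_n) : psd X ->
  exists (P : 'M[C]_n) (d : 'rV[C]_n),
    [/\ P^t* *m P = 1%:M, X = P^t* *m diag_mx d *m P & forall i, 0 <= d 0 i].
Proof.
move=> Xp; have /normal_spectral[P [d [PP XE dE]]] : X \is normalmx.
  by apply/normalmxP; rewrite psd_hermitian.
by exists P, d; split=> // i; have [v ->] := dE i.
Qed.

(** Take square roots of the eigenvalues; they are real, so conjugation leaves them fixed. *)
Lemma psd_factor n (X : 'M[C]_n) : psd X ->
  exists S : 'M[C]_n, X = S^t* *m S.
Proof.
move=> /psd_spectral[P [d [_ -> d0]]].
exists (diag_mx (map_mx sqrtC d) *m P).
rewrite adjmxM tr_diag_mx map_diag_mx !mulmxA.
rewrite -[in RHS](mulmxA (P^t* )) mulmx_diag.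
apply: (congr1 (fun D => P^t* *m diag_mx D *m P)); apply/rowP => i.
rewrite !mxE -[LHS]sqrtCK expr2; congr (_ * _).
by apply/esym/CrealP/ger0_real; rewrite sqrtC_ge0.
Qed.

Lemma psd_trace_ge0 n (X : 'M[C]_n) : psd X -> 0 <= \tr X.
Proof.
move=> Xp; apply: sumr_ge0 => i _; have := Xp (delta_mx i 0).
by rewrite trmx_delta map_delta_mx -rowE -colE !mxE.
Qed.

(** With [X = S^t* *m S], cyclicity turns the trace into that of the congruence of [Y] by [S^t*],
    which is again positive. *)
Lemma psd_trace_mul_ge0 n (X Y : 'M[C]_n) :
  psd X -> psd Y -> 0 <= \tr (X *m Y).
Proof.
move=> /psd_factor[S ->] Yp; rewrite -mulmxA mxtrace_mulC; apply: psd_trace_ge0.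
by rewrite -{1}[S]trmxCK; exact: psd_congr.
Qed.

(** In an eigenbasis this says that each eigenvalue is at most the sum of all of them, since they
    are nonnegative. *)
Lemma psd_le_trace n (X : 'M[C]_n) : psd X -> loewner_le X (\tr X)%:M.
Proof.
move=> /psd_spectral[P [d [PP XE d0]]].
have trX : \tr X = \sum_i d 0 i.
  by rewrite XE mxtrace_mulC mulmxA (mulmx1C PP) mul1mx mxtrace_diag.
rewrite /loewner_le.
have -> : (\tr X)%:M - X = P^t* *m diag_mx (const_mx (\tr X) - d) *m P.
  by rewrite raddfB/= diag_const_mx mulmxBr mulmxBl -XE
             mul_mx_scalar -scalemxAl PP scalemx1.
apply/psd_congr/psd_diag => i; rewrite !mxE trX (bigD1 i)//=.
by rewrite addrC addKr sumr_ge0.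
Qed.

Lemma adjmx_tens m n p q (A : 'M[C]_(m, n)) (B : 'M[C]_(p, q)) :
  (A *t B)^t* = A^t* *t B^t*.
Proof. by rewrite trmx_tens map_mxT. Qed.

Lemma psd_tens m n (X : 'M[C]_m) (Y : 'M[C]_n) :
  psd X -> psd Y -> psd (X *t Y).
Proof.
move=> /psd_factor[S ->] /psd_factor[T ->].
by rewrite -tensmx_mul -adjmx_tens; exact: psd_gram.
Qed.

Lemma Re_ge0 (z : C) : 0 <= z -> 0 <= complex.Re z.
Proof. by rewrite lecE => /andP[]. Qed.

(** Positivity can thus be tested by trace pairings with rank-one operators. *)
Lemma quadform_trace n (X : 'M[C]_n) (v : 'cV[C]_n) :
  (v^t* *m X *m v) 0 0 = \tr ((v *m v^t*) *m X).
Proof. by rewrite -!mulmxA [RHS]mxtrace_mulC -mulmxA /mxtrace big_ord1. Qed.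

Lemma trace_mul_delta m n (M : 'M[C]_(m, n)) i j :
  \tr (M *m delta_mx i j) = M j i.
Proof.
rewrite -(mul_delta_mx (0 : 'I_1)) mulmxA mxtrace_mulC mulmxA -rowE -colE.
by rewrite /mxtrace big_ord1 !mxE.
Qed.

Lemma trace_delta n (i : 'I_n) : \tr (delta_mx i i : 'M[C]_n) = 1.
Proof. by rewrite -[delta_mx i i]mul1mx trace_mul_delta mxE eqxx. Qed.

End PositiveMatrices.

(** * Conditional states of B and the measured state *)

Section Steering.
Variables (R : realType) (nA nB : nat).
Local Notation C := R[i].
Implicit Types (rho : 'M[C]_(nA * nB)) (M : 'M[C]_nA).

(* tr_A ((M (x) 1) rho), the unnormalised state of B conditioned on the
   outcome M of a measurement of A. *)
Definition steer rho M : 'M[C]_nB :=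
  \sum_i \sum_i' M i' i *: blockB rho i i'.

Lemma steer_is_linear rho : linear (steer rho).
Proof.
move=> a M N; rewrite /steer scaler_sumr -big_split; apply: eq_bigr => i _ /=.
rewrite scaler_sumr -big_split; apply: eq_bigr => i' _ /=.
by rewrite !mxE scalerDl scalerA.
Qed.

HB.instance Definition _ rho :=
  GRing.isLinear.Build C 'M[C]_nA 'M[C]_nB _ (steer rho) (steer_is_linear rho).

Lemma steer1 rho : steer rho 1%:M = ptraceA rho.
Proof.
apply: eq_bigr => i _; rewrite (bigD1 i)//= mxE eqxx scale1r.
rewrite big1 ?addr0// => i' /negbTE ii'.
by rewrite mxE ii' scale0r.
Qed.

(** This duality characterises the conditional operator by its pairings with operators on B, and it
    links the success probabilities to operator inequalities on B. *)
Lemma trace_steer rho M (N : 'M[C]_nB) :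
  \tr (N *m steer rho M) = \tr ((M *t N) *m rho).
Proof.
have -> : \tr ((M *t N) *m rho) = \sum_i \sum_i' M i i' *
    \sum_j \sum_j' N j j' * rho (mxtens_index (i', j')) (mxtens_index (i, j)).
  rewrite /mxtrace big_mxtens_index; apply: eq_bigr => i _.
  under [RHS]eq_bigr do rewrite mulr_sumr.
  rewrite exchange_big; apply: eq_bigr => j _.
  rewrite mxE big_mxtens_index; apply: eq_bigr => i' _.
  by rewrite mulr_sumr; apply: eq_bigr => j' _; rewrite tensmxE mulrA.
rewrite /steer mulmx_sumr raddf_sum [RHS]exchange_big; apply: eq_bigr => i _.
rewrite mulmx_sumr raddf_sum; apply: eq_bigr => i' _.
rewrite -scalemxAr /= mxtraceZ; congr (_ * _); apply: eq_bigr => j _.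
by rewrite mxE; apply: eq_bigr => j' _; rewrite mxE.
Qed.

Lemma psd_steer rho M : psd rho -> psd M -> psd (steer rho M).
Proof.
move=> rhop Mp v.
have -> : (v^t* *m steer rho M *m v) 0 0 = \tr ((M *t (v *m v^t*)) *m rho).
  by rewrite quadform_trace trace_steer.
apply: (psd_trace_mul_ge0 _ rhop); apply: (psd_tens Mp); exact: psd_outer.
Qed.

Lemma measurement_cq k (M : 'I_k -> 'M[C]_nA) rho :
  tens_id (measurement M) rho = \sum_x delta_mx x x *t steer rho (M x).
Proof.
apply/matrixP => a b; case: (mxtens_indexP a) => x j.
case: (mxtens_indexP b) => y j'.
rewrite !summxE.
under eq_bigr do rewrite summxE.
under [RHS]eq_bigr do rewrite tensmxE summxE mulr_sumr.
rewrite [RHS]exchange_big; apply: eq_bigr => i _.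
under [RHS]eq_bigr do rewrite summxE mulr_sumr.
rewrite [RHS]exchange_big; apply: eq_bigr => i' _.
rewrite tensmxE summxE mulr_suml; apply: eq_bigr => z _.
by rewrite trace_mul_delta [X in X * _]mxE [X in _ = _ * X]mxE -mulrA mulrCA.
Qed.

Lemma psd_cq k (G : 'I_k -> 'M[C]_nB) :
  psd (\sum_x delta_mx x x *t G x) <-> forall x, psd (G x).
Proof.
split=> [Gp x v|Gp]; last first.
  by apply: psd_sum => x; apply: psd_tens => //; exact: psd_delta.
have -> : (v^t* *m G x *m v) 0 0 =
    \tr ((delta_mx x x *t (v *m v^t*)) *m \sum_y delta_mx y y *t G y).
  rewrite mulmx_sumr raddf_sum (bigD1 x)//= big1 => [|y /negbTE yx].
    rewrite addr0 tensmx_mul mul_delta_mx mxtrace_tens trace_delta mul1r.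
    exact: quadform_trace.
  by rewrite tensmx_mul mul_delta_mx_cond eq_sym yx mulr0n tens0mx mxtrace0.
apply: (psd_trace_mul_ge0 _ Gp); apply: psd_tens; first exact: psd_delta.
exact: psd_outer.
Qed.

Lemma acc_bound_steer rho l : acc_bound rho l <->
  forall k (M : 'I_k -> 'M[C]_nA), povm M ->
  exists2 lambda : 'I_k -> R, prob_distr lambda &
    forall x, loewner_le (steer rho (M x))
                ((2 `^ l * lambda x)%:C *: ptraceA rho).
Proof.
suff gapE k (M : 'I_k -> 'M[C]_nA) (lambda : 'I_k -> R) :
    loewner_le (tens_id (measurement M) rho) ((2 `^ l)%:C *:
      ((\sum_x (lambda x)%:C *: delta_mx x x) *t ptraceA rho)) <->
    forall x, loewner_le (steer rho (M x))
                ((2 `^ l * lambda x)%:C *: ptraceA rho).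
  by split=> rho_l k M /(rho_l k M)[lambda lambdaP /gapE]; exists lambda.
rewrite -psd_cq measurement_cq /loewner_le.
(* Once the blockwise gaps are assembled into one block-diagonal operator, only an identity of
   operators is left. *)
suff -> : (2 `^ l)%:C *:
    ((\sum_x (lambda x)%:C *: delta_mx x x) *t ptraceA rho) -
    \sum_x delta_mx x x *t steer rho (M x) =
  \sum_x delta_mx x x *t
    ((2 `^ l * lambda x)%:C *: ptraceA rho - steer rho (M x)) by [].
move: (ptraceA rho) => rhoB; apply/matrixP => a b.
rewrite !mxE !summxE mulr_suml mulr_sumr -sumrB.
apply: eq_bigr => x _; rewrite !mxE mulrBr rmorphM/=; congr (_ - _).
by rewrite -!mulrA [RHS]mulrCA; congr (_ * _); exact: mulrCA.
Qed.

(** A trace over an empty basis is 0, not 1; this makes division by [nA] legitimate below. *)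
Lemma trace_dim_gt0 rho : \tr rho = 1 -> (0 < nA)%N.
Proof.
rewrite lt0n => tr1; apply/eqP => nA0; move: tr1.
rewrite /mxtrace big_mxtens_index big1 => [/eqP|i _].
  by rewrite eq_sym oner_eq0.
by have := ltn_ord i; rewrite {2}nA0.
Qed.

Lemma steer_le rho M : psd rho -> psd M ->
  loewner_le (steer rho M) (\tr M *: ptraceA rho).
Proof.
move=> rhop Mp; rewrite /loewner_le -steer1 -linearZ -linearB/= scalemx1.
exact/psd_steer/psd_le_trace.
Qed.

Lemma acc_bound_log_dim rho : density rho ->
  acc_bound rho (ln nA%:R / ln 2).
Proof.
move=> [rhop tr1]; have nA0 : 0 < nA%:R :> R.
  by rewrite ltr0n (trace_dim_gt0 tr1).
apply/acc_bound_steer => k M [Mp M1].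
(* The exponent is the base-2 logarithm of [nA]. *)
have powE : 2 `^ (ln nA%:R / ln 2) = nA%:R :> R.
  rewrite /powR pnatr_eq0/= divfK ?lnK ?posrE//.
  by rewrite gt_eqF// ln_gt0// ltr1n.
have trE x : (complex.Re (\tr (M x)))%:C = \tr (M x).
  by apply/RRe_real/ger0_real/psd_trace_ge0.
exists (fun x => complex.Re (\tr (M x)) / nA%:R); last first.
  by move=> x; rewrite powE mulrCA divff ?gt_eqF// mulr1 trE; exact: steer_le.
split=> [x|].
  by rewrite divr_ge0 ?ler0n// -ler0c trE psd_trace_ge0.
(* Normalisation: the traces of the POVM elements add up to the trace of the identity, which is
   [nA]. *)
rewrite -mulr_suml; apply/(mulIf (lt0r_neq0 nA0)).
rewrite divfK ?gt_eqF// mul1r; apply: complexI.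
rewrite rmorph_sum; under eq_bigr do rewrite /= trE.
by rewrite -raddf_sum M1 /= mxtrace1 rmorph_nat.
Qed.

Lemma psd_ptraceA rho : psd rho -> psd (ptraceA rho).
Proof.
move=> rhop; rewrite -steer1; apply: psd_steer => //.
by rewrite -diag_const_mx; apply: psd_diag => i; rewrite mxE ler01.
Qed.

(** * Success probabilities *)

Variables (J : finType) (E : J -> bool -> 'M[C]_nB).
Hypothesis hE : forall j, povm (E j).

Lemma effect_prob_ge0 rho j : psd rho ->
  0 <= complex.Re (\tr (E j true *m ptraceA rho)).
Proof.
move=> rhop; have [Ep _] := hE j; apply: Re_ge0.
by apply: (psd_trace_mul_ge0 (Ep true)); exact: psd_ptraceA.
Qed.

Lemma le_Psucc_NA rho j : psd rho ->
  complex.Re (\tr (E j true *m ptraceA rho)) <= Psucc_NA rho E.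
Proof.
move=> rhop; apply: ub_le_sup; last by exists j.
(* All terms are nonnegative, so their sum bounds each of them and the supremum is that of a bounded
   set. *)
exists (\sum_i complex.Re (\tr (E i true *m ptraceA rho))) => _ [i _ <-].
rewrite (bigD1 i)//= lerDl; apply: sumr_ge0 => i' _; exact: effect_prob_ge0.
Qed.

Lemma acc_bound_succ rho l (F : J -> 'M[C]_nA) :
  psd rho -> acc_bound rho l -> povm F ->
  \sum_j complex.Re (\tr ((F j *t E j true) *m rho)) <=
    2 `^ l * Psucc_NA rho E.
Proof.
move=> rhop /acc_bound_steer rho_l [Fp F1].
have sumJ (V : nmodType) (G : J -> V) :
    \sum_j G j = \sum_(x < #|J|) G (enum_val x).
  exact: big_enum_val.
(* Outcomes in [acc_bound] are ordinals, so the POVM is relabelled along the enumeration of [J]. *)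
have [|lambda [lambda0 lambda1] lambdaP] := rho_l #|J| (F \o enum_val).
  by split=> [x|]; [exact: Fp | rewrite -F1 sumJ].
(* Writing 1 as the sum of the [lambda x] on the right reduces the claim to a termwise
   comparison. *)
rewrite sumJ -[leRHS]mul1r -[X in _ <= X * _]lambda1 mulr_suml.
apply: ler_sum => x _.
set j := enum_val x; have [Ep _] := hE j.
apply: (@le_trans _ _
    (2 `^ l * lambda x * complex.Re (\tr (E j true *m ptraceA rho)))).
  have := psd_trace_mul_ge0 (Ep true) (lambdaP x).
  rewrite mulmxBr raddfB /= trace_steer -scalemxAr mxtraceZ subr_ge0 lecE.
  by case: (\tr (_ *m ptraceA _)) => a b /andP[_]/=; rewrite mul0r subr0.
rewrite [leRHS]mulrCA [leRHS]mulrA; apply: ler_wpM2l; last exact: le_Psucc_NA.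
by rewrite mulr_ge0 ?powR_ge0.
Qed.

End Steering.

(** * Passing to the infimum of the exponents *)

(** No continuity argument is made: when [a] and [p] are positive, taking logarithms turns the
    hypothesis into the fixed lower bound [ln (a / p) / ln 2] of [S], which is then below
    [inf S]. *)
Lemma le_powR_inf (R : realType) (S : set R) (a p : R) :
  S !=set0 -> 0 <= p -> (forall l, S l -> a <= 2 `^ l * p) ->
  a <= 2 `^ (inf S) * p.
Proof.
move=> S0 p0 aS; have [a0|a0] := leP a 0.
  by rewrite (le_trans a0)// mulr_ge0 ?powR_ge0.
have ln2 : 0 < ln 2 :> R by rewrite ln_gt0// ltr1n.
have pp : 0 < p.
  rewrite lt_neqAle p0 andbT; apply/eqP => p0'.
  by have [l /aS] := S0; rewrite -p0' mulr0 leNgt a0.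
rewrite -ler_pdivrMr// -ler_ln ?posrE ?divr_gt0 ?powR_gt0//.
rewrite ln_powR -ler_pdivrMr//; apply: lb_le_inf => // l /aS.
rewrite -ler_pdivrMr// -ler_ln ?posrE ?divr_gt0 ?powR_gt0// ln_powR.
by rewrite ler_pdivrMr.
Qed.

Theorem corollary1 (R : realType) (nA nB : nat) (rho : 'M[R[i]]_(nA * nB))
    (hrho : density rho) (J : finType) (hJ : (0 < #|J|)%N)
    (E : J -> bool -> 'M[R[i]]_nB) (hE : forall j : J, povm (E j)) :
  Psucc_A rho E <= 2 `^ (Imax_acc rho) * Psucc_NA rho E.
Proof.
have [rhop _] := hrho; have [j _] := card_gt0P hJ.
have NA0 := le_trans (effect_prob_ge0 hE j rhop) (le_Psucc_NA hE j rhop).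
rewrite /Psucc_A; set S := [set _ | _ in _].
(* The supremum of the empty set is 0 by convention, so there nonnegativity of the right-hand side
   suffices. *)
have [->|S0] := eqVneq S set0; first by rewrite sup0 mulr_ge0 ?powR_ge0.
apply: ge_sup; first exact/set0P.
move=> _ [F Fpovm <-]; apply: le_powR_inf => //.
  by exists (ln nA%:R / ln 2); exact: acc_bound_log_dim.
by move=> l rho_l; exact: acc_bound_succ.
Qed.
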